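(* Let $K$ be a field with $\mathrm{char}(K)\neq 2$ and let $\mathfrak{g}$ be a Lie algebra over $K$ that is $2$-generated (generated as a Lie algebra by two elements) and nilpotent of class $c$. Then $\chi(\mathfrak{g})$ is nilpotent of class at most $c+1$.
   Context: For a Lie algebra $\mathfrak{g}$ over $K$, let $\mathfrak{g}^{\psi}$ be an isomorphic copy of $\mathfrak{g}$ via $x\mapsto x^{\psi}$, and let $\chi(\mathfrak{g})=\langle \mathfrak{g},\mathfrak{g}^{\psi} \mid [x,x^{\psi}]=0 \text{ for all } x\in\mathfrak{g}\rangle$ (the quotient of the free product of the Lie algebras $\mathfrak{g}$ and $\mathfrak{g}^{\psi}$ by the ideal generated by all $[x,x^{\psi}]$). *)

(* Defs.v *)
From HB Require Import structures.
From mathcomp Require Import all_boot all_order all_algebra.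
From mathcomp Require Import all_classical.

Set Implicit Arguments.
Unset Strict Implicit.
Unset Printing Implicit Defensive.

Import GRing.Theory.
Local Open Scope ring_scope.
Local Open Scope classical_set_scope.
Local Open Scope quotient_scope.

Reserved Notation "[ 'lie' x , y ]" (format "[ 'lie'  x ,  y ]").

HB.mixin Record Lmodule_isLieAlgebra (K : fieldType) L of GRing.Lmodule K L := {
  lie : L -> L -> L;
  lie_linearl : forall y, linear (lie^~ y);
  lie_linearr : forall x, linear (lie x);
  liexx : forall x, lie x x = 0;
  lie_jacobi : forall x y z,
    lie x (lie y z) + lie y (lie z x) + lie z (lie x y) = 0
}.

#[short(type="lieAlgType")]
HB.structure Definition LieAlgebra (K : fieldType) :=
  { L of GRing.Lmodule K L & Lmodule_isLieAlgebra K L }.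

Notation "[ 'lie' x , y ]" := (lie x y) : ring_scope.

Definition is_lie_hom (K : fieldType) (A B : lieAlgType K) (f : A -> B) :=
  linear f /\ forall x y, f [lie x, y] = [lie f x, f y].

Section Subobjects.
Variables (K : fieldType) (L : lieAlgType K).
Implicit Types (S G : set L).

Definition is_submodule S :=
  S 0 /\ forall (a : K) x y, S x -> S y -> S (a *: x + y).

Definition is_lie_subalgebra S :=
  is_submodule S /\ forall x y, S x -> S y -> S [lie x, y].

Definition is_lie_ideal S :=
  is_submodule S /\ forall x y, S y -> S [lie x, y].

Definition two_generated :=
  exists a b : L, smallest is_lie_subalgebra [set a; b] = setT.

(* [lcs i] is the term gamma_(i+1) of the lower central series: the linear
   span of the brackets of elements of gamma_i with elements of [L]. *)
Fixpoint lcs (i : nat) : set L :=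
  if i is j.+1 then
    smallest is_submodule [set z | exists x y, lcs j x /\ z = [lie x, y]]
  else setT.

(* The class is the exact one: the least [c] with gamma_(c+1) = 0. *)
Definition nilpotent_of_class (c : nat) :=
  lcs c = [set 0] /\ forall m, lcs m = [set 0] -> (c <= m)%N.

Record lieIdeal := LieIdeal {
  lie_ideal_set :> L -> Prop;
  lie_idealP : is_lie_ideal lie_ideal_set
}.

Lemma smallest_is_lie_ideal G : is_lie_ideal (smallest is_lie_ideal G).
Proof.
split; last by move=> x y Sy I cI; apply: cI.1.2; exact: Sy I cI.
split=> [I [[[I0 _] _] _] //|a x y Sx Sy I cI].
by apply: cI.1.1.2; [exact: Sx I cI | exact: Sy I cI].
Qed.

Definition lie_ideal_gen G : lieIdeal := LieIdeal (smallest_is_lie_ideal G).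

End Subobjects.

Arguments two_generated {K} L.
Arguments nilpotent_of_class {K} L c.

Section Quotient.
Variables (K : fieldType) (L : lieAlgType K) (I : lieIdeal L).

Definition ideal_rel (x y : L) : bool := `[< I (x - y) >].

Let I0 : I 0. Proof. by case: (lie_idealP I) => [[h _] _]. Qed.
Let IZD a x y : I x -> I y -> I (a *: x + y).
Proof. by case: (lie_idealP I) => [[_ h] _]; exact: h. Qed.
Let ID x y : I x -> I y -> I (x + y).
Proof. by move=> Ix Iy; rewrite -[x]scale1r; exact: IZD. Qed.
Let IZ a x : I x -> I (a *: x).
Proof. by move=> Ix; rewrite -[_ *: _]addr0; exact: IZD. Qed.
Let IN x : I x -> I (- x).
Proof. by move=> Ix; rewrite -scaleN1r; exact: IZ. Qed.
Let IL x y : I y -> I [lie x, y].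
Proof. by case: (lie_idealP I) => [_ h]; exact: h. Qed.
Let lieC (x y : L) : [lie x, y] = - [lie y, x].
Proof.
have lD u v w : [lie u + v, w] = [lie u, w] + [lie v, w] :> L.
  by have := lie_linearl w 1 u v; rewrite /= !scale1r.
have lDr u v w : [lie w, u + v] = [lie w, u] + [lie w, v] :> L.
  by have := lie_linearr w 1 u v; rewrite /= !scale1r.
apply/eqP; rewrite -addr_eq0; apply/eqP.
by have := liexx (x + y); rewrite lD !lDr !liexx add0r addr0.
Qed.

Lemma ideal_rel_equiv : equiv_class_of ideal_rel.
Proof.
split=> [x|x y|y x z]; rewrite /ideal_rel.
- by rewrite subrr; apply/asboolP.
- by apply/asboolP/asboolP => /IN; rewrite opprB.
- move=> /asboolP h1 /asboolP h2; apply/asboolP.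
  by rewrite -[x](addrNK y) -addrA; exact: ID.
Qed.

Canonical ideal_equiv_rel := EquivRelPack ideal_rel_equiv.
Canonical ideal_encModRel := defaultEncModRel ideal_rel.

Definition lie_quot : Type := {eq_quot ideal_rel}.
HB.instance Definition _ := Choice.on lie_quot.
HB.instance Definition _ : EqQuotient L ideal_rel lie_quot :=
  EqQuotient.on lie_quot.

Definition lie_quot_pi (x : L) : lie_quot := \pi_lie_quot x.

Lemma lie_quot_piE x y : (lie_quot_pi x = lie_quot_pi y) <-> I (x - y).
Proof.
split=> [/eqP|h]; last apply/eqP; rewrite /lie_quot_pi piE /ideal_rel.
  by move/asboolP.
exact/asboolP.
Qed.

Local Notation pi := lie_quot_pi.
Local Notation rep := (@repr _ lie_quot).

Let piK (q : lie_quot) : pi (rep q) = q. Proof. exact: reprK. Qed.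
Let Irep x : I (rep (pi x) - x). Proof. by apply/lie_quot_piE; rewrite piK. Qed.

Definition lie_quot_zero : lie_quot := pi 0.
Definition lie_quot_add (p q : lie_quot) : lie_quot := pi (rep p + rep q).
Definition lie_quot_opp (p : lie_quot) : lie_quot := pi (- rep p).
Definition lie_quot_scale (a : K) (p : lie_quot) : lie_quot := pi (a *: rep p).
Definition lie_quot_lie (p q : lie_quot) : lie_quot := pi [lie rep p, rep q].

Let piD x y : lie_quot_add (pi x) (pi y) = pi (x + y).
Proof. by apply/lie_quot_piE; rewrite opprD addrACA; apply: ID. Qed.
Let piN x : lie_quot_opp (pi x) = pi (- x).
Proof. by apply/lie_quot_piE; rewrite -opprD; apply: IN. Qed.
Let piZ a x : lie_quot_scale a (pi x) = pi (a *: x).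
Proof. by apply/lie_quot_piE; rewrite -scalerBr; apply: IZ. Qed.
Let piL x y : lie_quot_lie (pi x) (pi y) = pi [lie x, y].
Proof.
apply/lie_quot_piE; set x' := rep _; set y' := rep _.
have lBr (u v w : L) : [lie w, u - v] = [lie w, u] - [lie w, v].
  have := lie_linearr w (-1) v u.
  by rewrite /= !scaleN1r (addrC (- v)) (addrC (- lie _ _)).
have -> : [lie x', y'] - [lie x, y]
        = [lie x', y' - y] - [lie y, x' - x].
  by rewrite !lBr (lieC y x') (lieC y x) !opprB !opprK (addrC (- lie x y)) addrA addrNK.
by apply: ID; [|apply: IN]; apply: IL; exact: Irep.
Qed.

Let addqA : associative lie_quot_add.
Proof. by move=> x y z; rewrite -[x]piK -[y]piK -[z]piK !piD addrA. Qed.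
Let addqC : commutative lie_quot_add.
Proof. by move=> x y; rewrite -[x]piK -[y]piK !piD addrC. Qed.
Let add0q : left_id lie_quot_zero lie_quot_add.
Proof. by move=> x; rewrite -[x]piK piD add0r. Qed.
Let addNq : left_inverse lie_quot_zero lie_quot_opp lie_quot_add.
Proof. by move=> x; rewrite -[x]piK piN piD addNr. Qed.
HB.instance Definition _ :=
  GRing.isZmodule.Build lie_quot addqA addqC add0q addNq.

Let addE (p q : lie_quot) : p + q = lie_quot_add p q. Proof. by []. Qed.
Let scaleqA a b q :
  lie_quot_scale a (lie_quot_scale b q) = lie_quot_scale (a * b) q.
Proof. by rewrite -[q]piK !piZ scalerA. Qed.
Let scale1q : left_id 1 lie_quot_scale.
Proof. by move=> q; rewrite -[q]piK piZ scale1r. Qed.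
Let scaleqDr : right_distributive lie_quot_scale +%R.
Proof.
by move=> a p q; rewrite -[p]piK -[q]piK addE piD !piZ addE piD scalerDr.
Qed.
Let scaleqDl q : {morph lie_quot_scale^~ q : a b / a + b}.
Proof. by move=> a b; rewrite -[q]piK /= !piZ addE piD scalerDl. Qed.
HB.instance Definition _ :=
  GRing.Zmodule_isLmodule.Build K lie_quot scaleqA scale1q scaleqDr scaleqDl.

Let scaleE a (q : lie_quot) : a *: q = lie_quot_scale a q. Proof. by []. Qed.
Let lieq_linearl q : linear (lie_quot_lie^~ q).
Proof.
move=> a x y; rewrite -[x]piK -[y]piK -[q]piK /=.
have := lie_linearl (rep q) a (rep x) (rep y); rewrite /= => E.
by rewrite scaleE piZ addE piD !piL scaleE piZ addE piD E.
Qed.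
Let lieq_linearr q : linear (lie_quot_lie q).
Proof.
move=> a x y; rewrite -[x]piK -[y]piK -[q]piK /=.
have := lie_linearr (rep q) a (rep x) (rep y); rewrite /= => E.
by rewrite scaleE piZ addE piD !piL scaleE piZ addE piD E.
Qed.
Let lieqxx q : lie_quot_lie q q = 0.
Proof. by rewrite -[q]piK piL liexx. Qed.
Let lieq_jacobi x y z :
  lie_quot_lie x (lie_quot_lie y z) + lie_quot_lie y (lie_quot_lie z x)
  + lie_quot_lie z (lie_quot_lie x y) = 0.
Proof.
rewrite -[x]piK -[y]piK -[z]piK !piL.
by rewrite !(addE, piD) lie_jacobi.
Qed.
HB.instance Definition _ :=
  Lmodule_isLieAlgebra.Build K lie_quot
    lieq_linearl lieq_linearr lieqxx lieq_jacobi.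

End Quotient.

(* The free product (coproduct) of two Lie algebras: formal Lie expressions in
   the elements of [L1] and [L2], modulo the least congruence that imposes the
   axioms of Lie algebras and makes both inclusions Lie homomorphisms. *)
Section FreeProduct.
Variables (K : fieldType) (L1 L2 : lieAlgType K).

Inductive fp_term : Type :=
| FpInl of L1
| FpInr of L2
| FpZero
| FpAdd of fp_term & fp_term
| FpOpp of fp_term
| FpScale of K & fp_term
| FpLie of fp_term & fp_term.

Inductive fp_eq : fp_term -> fp_term -> Prop :=
| fp_refl t : fp_eq t t
| fp_sym s t : fp_eq s t -> fp_eq t s
| fp_trans s t u : fp_eq s t -> fp_eq t u -> fp_eq s u
| fp_congD s s' t t' :
    fp_eq s s' -> fp_eq t t' -> fp_eq (FpAdd s t) (FpAdd s' t')
| fp_congN s s' : fp_eq s s' -> fp_eq (FpOpp s) (FpOpp s')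
| fp_congZ a s s' : fp_eq s s' -> fp_eq (FpScale a s) (FpScale a s')
| fp_congL s s' t t' :
    fp_eq s s' -> fp_eq t t' -> fp_eq (FpLie s t) (FpLie s' t')
| fp_addA s t u : fp_eq (FpAdd s (FpAdd t u)) (FpAdd (FpAdd s t) u)
| fp_addC s t : fp_eq (FpAdd s t) (FpAdd t s)
| fp_add0 t : fp_eq (FpAdd FpZero t) t
| fp_addN t : fp_eq (FpAdd (FpOpp t) t) FpZero
| fp_scaleA a b t : fp_eq (FpScale a (FpScale b t)) (FpScale (a * b) t)
| fp_scale1 t : fp_eq (FpScale 1 t) t
| fp_scaleDr a s t :
    fp_eq (FpScale a (FpAdd s t)) (FpAdd (FpScale a s) (FpScale a t))
| fp_scaleDl a b t :
    fp_eq (FpScale (a + b) t) (FpAdd (FpScale a t) (FpScale b t))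
| fp_lie_linearl a s t u :
    fp_eq (FpLie (FpAdd (FpScale a s) t) u)
          (FpAdd (FpScale a (FpLie s u)) (FpLie t u))
| fp_lie_linearr a s t u :
    fp_eq (FpLie u (FpAdd (FpScale a s) t))
          (FpAdd (FpScale a (FpLie u s)) (FpLie u t))
| fp_liexx t : fp_eq (FpLie t t) FpZero
| fp_lie_jacobi s t u :
    fp_eq (FpAdd (FpAdd (FpLie s (FpLie t u)) (FpLie t (FpLie u s)))
                 (FpLie u (FpLie s t))) FpZero
| fp_inl_linear a x y :
    fp_eq (FpInl (a *: x + y)) (FpAdd (FpScale a (FpInl x)) (FpInl y))
| fp_inl_lie x y : fp_eq (FpInl [lie x, y]) (FpLie (FpInl x) (FpInl y))
| fp_inr_linear a x y :
    fp_eq (FpInr (a *: x + y)) (FpAdd (FpScale a (FpInr x)) (FpInr y))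
| fp_inr_lie x y : fp_eq (FpInr [lie x, y]) (FpLie (FpInr x) (FpInr y)).

HB.instance Definition _ := gen_eqMixin fp_term.
HB.instance Definition _ := gen_choiceMixin fp_term.

Definition fp_rel (s t : fp_term) : bool := `[< fp_eq s t >].

Lemma fp_rel_equiv : equiv_class_of fp_rel.
Proof.
split=> [x|x y|y x z]; rewrite /fp_rel.
- by apply/asboolP; exact: fp_refl.
- by apply/asboolP/asboolP; exact: fp_sym.
- by move=> /asboolP h1 /asboolP h2; apply/asboolP; exact: fp_trans h1 h2.
Qed.

Canonical fp_equiv_rel := EquivRelPack fp_rel_equiv.
Canonical fp_encModRel := defaultEncModRel fp_rel.

Definition freeprod : Type := {eq_quot fp_rel}.
HB.instance Definition _ := Choice.on freeprod.
HB.instance Definition _ : EqQuotient fp_term fp_rel freeprod :=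
  EqQuotient.on freeprod.

Definition fp_pi (t : fp_term) : freeprod := \pi_freeprod t.

Lemma fp_piE s t : (fp_pi s = fp_pi t) <-> fp_eq s t.
Proof.
split=> [/eqP|h]; last apply/eqP; rewrite /fp_pi piE /fp_rel.
  by move/asboolP.
exact/asboolP.
Qed.

Local Notation rep := (@repr _ freeprod).

Let piK (q : freeprod) : fp_pi (rep q) = q. Proof. exact: reprK. Qed.
Let eqrep t : fp_eq (rep (fp_pi t)) t. Proof. by apply/fp_piE; rewrite piK. Qed.

Definition fp_zero : freeprod := fp_pi FpZero.
Definition fp_add (p q : freeprod) : freeprod := fp_pi (FpAdd (rep p) (rep q)).
Definition fp_opp (p : freeprod) : freeprod := fp_pi (FpOpp (rep p)).
Definition fp_scale (a : K) (p : freeprod) : freeprod :=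
  fp_pi (FpScale a (rep p)).
Definition fp_lie (p q : freeprod) : freeprod := fp_pi (FpLie (rep p) (rep q)).

Let piD s t : fp_add (fp_pi s) (fp_pi t) = fp_pi (FpAdd s t).
Proof. by apply/fp_piE; apply: fp_congD. Qed.
Let piN t : fp_opp (fp_pi t) = fp_pi (FpOpp t).
Proof. by apply/fp_piE; apply: fp_congN. Qed.
Let piZ a t : fp_scale a (fp_pi t) = fp_pi (FpScale a t).
Proof. by apply/fp_piE; apply: fp_congZ. Qed.
Let piL s t : fp_lie (fp_pi s) (fp_pi t) = fp_pi (FpLie s t).
Proof. by apply/fp_piE; apply: fp_congL. Qed.

Let fpaddA : associative fp_add.
Proof.
move=> x y z; rewrite -[x]piK -[y]piK -[z]piK !piD.
by apply/fp_piE; exact: fp_addA.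
Qed.
Let fpaddC : commutative fp_add.
Proof.
by move=> x y; rewrite -[x]piK -[y]piK !piD; apply/fp_piE; exact: fp_addC.
Qed.
Let fpadd0 : left_id fp_zero fp_add.
Proof. by move=> x; rewrite -[x]piK piD; apply/fp_piE; exact: fp_add0. Qed.
Let fpaddN : left_inverse fp_zero fp_opp fp_add.
Proof. by move=> x; rewrite -[x]piK piN piD; apply/fp_piE; exact: fp_addN. Qed.
HB.instance Definition _ :=
  GRing.isZmodule.Build freeprod fpaddA fpaddC fpadd0 fpaddN.

Let fpaddE (p q : freeprod) : p + q = fp_add p q. Proof. by []. Qed.
Let fpscaleA a b q : fp_scale a (fp_scale b q) = fp_scale (a * b) q.
Proof. by rewrite -[q]piK !piZ; apply/fp_piE; exact: fp_scaleA. Qed.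
Let fpscale1 : left_id 1 fp_scale.
Proof. by move=> q; rewrite -[q]piK piZ; apply/fp_piE; exact: fp_scale1. Qed.
Let fpscaleDr : right_distributive fp_scale +%R.
Proof.
move=> a p q; rewrite -[p]piK -[q]piK fpaddE piD !piZ fpaddE piD.
by apply/fp_piE; exact: fp_scaleDr.
Qed.
Let fpscaleDl q : {morph fp_scale^~ q : a b / a + b}.
Proof.
move=> a b; rewrite -[q]piK /= !piZ fpaddE piD.
by apply/fp_piE; exact: fp_scaleDl.
Qed.
HB.instance Definition _ :=
  GRing.Zmodule_isLmodule.Build K freeprod
    fpscaleA fpscale1 fpscaleDr fpscaleDl.

Let scaleE a (q : freeprod) : a *: q = fp_scale a q. Proof. by []. Qed.

Let fplie_linearl q : linear (fp_lie^~ q).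
Proof.
move=> a x y; rewrite -[x]piK -[y]piK -[q]piK /=.
rewrite scaleE piZ fpaddE piD !piL scaleE piZ fpaddE piD.
by apply/fp_piE; exact: fp_lie_linearl.
Qed.
Let fplie_linearr q : linear (fp_lie q).
Proof.
move=> a x y; rewrite -[x]piK -[y]piK -[q]piK /=.
rewrite scaleE piZ fpaddE piD !piL scaleE piZ fpaddE piD.
by apply/fp_piE; exact: fp_lie_linearr.
Qed.
Let fpliexx q : fp_lie q q = 0.
Proof. by rewrite -[q]piK piL; apply/fp_piE; exact: fp_liexx. Qed.
Let fplie_jacobi x y z :
  fp_lie x (fp_lie y z) + fp_lie y (fp_lie z x) + fp_lie z (fp_lie x y) = 0.
Proof.
rewrite -[x]piK -[y]piK -[z]piK !piL !(fpaddE, piD).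
by apply/fp_piE; exact: fp_lie_jacobi.
Qed.
HB.instance Definition _ :=
  Lmodule_isLieAlgebra.Build K freeprod
    fplie_linearl fplie_linearr fpliexx fplie_jacobi.

Definition fp_inl (x : L1) : freeprod := fp_pi (FpInl x).
Definition fp_inr (x : L2) : freeprod := fp_pi (FpInr x).

Lemma fp_inl_hom : is_lie_hom fp_inl.
Proof.
split=> [a x y|x y]; rewrite /fp_inl /=.
  by rewrite fpaddE scaleE piZ piD; apply/fp_piE; exact: fp_inl_linear.
by rewrite -[RHS]/(fp_lie _ _) piL; apply/fp_piE; exact: fp_inl_lie.
Qed.

Lemma fp_inr_hom : is_lie_hom fp_inr.
Proof.
split=> [a x y|x y]; rewrite /fp_inr /=.
  by rewrite fpaddE scaleE piZ piD; apply/fp_piE; exact: fp_inr_linear.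
by rewrite -[RHS]/(fp_lie _ _) piL; apply/fp_piE; exact: fp_inr_lie.
Qed.

Section Universal.
Variables (M : lieAlgType K) (f1 : L1 -> M) (f2 : L2 -> M).
Hypotheses (hf1 : is_lie_hom f1) (hf2 : is_lie_hom f2).

Fixpoint fp_eval (t : fp_term) : M :=
  match t with
  | FpInl x => f1 x
  | FpInr x => f2 x
  | FpZero => 0
  | FpAdd s t => fp_eval s + fp_eval t
  | FpOpp t => - fp_eval t
  | FpScale a t => a *: fp_eval t
  | FpLie s t => [lie fp_eval s, fp_eval t]
  end.

Lemma fp_eval_eq s t : fp_eq s t -> fp_eval s = fp_eval t.
Proof.
elim=> //=.
- by move=> ? ? ? _ -> _ ->.
- by move=> ? ? ? ? _ -> _ ->.
- by move=> ? ? _ ->.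
- by move=> ? ? ? _ ->.
- by move=> ? ? ? ? _ -> _ ->.
- by move=> *; rewrite addrA.
- by move=> *; rewrite addrC.
- by move=> *; rewrite add0r.
- by move=> *; rewrite addNr.
- by move=> *; rewrite scalerA.
- by move=> *; rewrite scale1r.
- by move=> *; rewrite scalerDr.
- by move=> *; rewrite scalerDl.
- by move=> *; exact: lie_linearl.
- by move=> *; exact: lie_linearr.
- by move=> *; exact: liexx.
- by move=> *; exact: lie_jacobi.
- by move=> *; exact: hf1.1.
- by move=> *; exact: hf1.2.
- by move=> *; exact: hf2.1.
- by move=> *; exact: hf2.2.
Qed.

Theorem freeprod_universal : exists! f : freeprod -> M,
  [/\ is_lie_hom f, forall x, f (fp_inl x) = f1 x
    & forall x, f (fp_inr x) = f2 x].
Proof.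
pose f (p : freeprod) := fp_eval (rep p).
have fpi t : f (fp_pi t) = fp_eval t by exact: fp_eval_eq.
exists f; split.
  split=> [|x|x]; rewrite ?fpi //.
  split=> [a x y|x y]; rewrite -[x]piK -[y]piK.
    by rewrite fpaddE scaleE piZ piD !fpi.
  by rewrite -[lie _ _]/(fp_lie _ _) piL !fpi.
move=> g [[glin glie] gl gr]; apply/funext => p; rewrite -[p]piK fpi.
have gD x y : g (x + y) = g x + g y.
  by rewrite -[x]scale1r glin !scale1r.
have g0 : g 0 = 0 by apply: (addrI (g 0)); rewrite -gD !addr0.
have gN x : g (- x) = - g x.
  by apply: (addIr (g x)); rewrite -gD !addNr.
have gZ a x : g (a *: x) = a *: g x.
  by rewrite -[a *: x]addr0 glin g0 addr0.
elim: (rep p) => /=.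
- by move=> x; rewrite -gl.
- by move=> x; rewrite -gr.
- by rewrite -[LHS]g0.
- by move=> s -> t ->; rewrite -gD fpaddE piD.
- by move=> t ->; rewrite -gN -piN.
- by move=> a t ->; rewrite -gZ scaleE piZ.
- by move=> s -> t ->; rewrite -glie -piL.
Qed.

End Universal.
End FreeProduct.

(* The right-hand factor of [freeprod g g] plays the role of the isomorphic
   copy of [g]: [fp_inl x] stands for x and [fp_inr x] for x^psi. *)
Definition chi_relators (K : fieldType) (g : lieAlgType K) :
    set (freeprod g g) :=
  [set [lie (fp_inl g x : freeprod g g), (fp_inr g x : freeprod g g)]
     | x in [set: g]].

Arguments chi_relators {K} g.

Definition chi (K : fieldType) (g : lieAlgType K) : Type :=
  lie_quot (lie_ideal_gen (chi_relators g)).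

HB.instance Definition _ (K : fieldType) (g : lieAlgType K) :=
  LieAlgebra.on (chi g).

(* Main.v *)
Require Import Defs.
From mathcomp Require Import all_boot all_order all_algebra.
From mathcomp Require Import all_classical.
From mathcomp Require Import zify.

Set Implicit Arguments.
Unset Strict Implicit.
Unset Printing Implicit Defensive.

Import GRing.Theory.
Local Open Scope ring_scope.
Local Open Scope classical_set_scope.

(** Write [x'] for the image in [chi g] of [x] in the second copy of [g], and
    put [B x y = [x, y']].

    Linearizing [[x, x'] = 0] says that [B] is alternating.  Expanding
    [[x, B y z]] with the Jacobi identity and solving the resulting cyclic
    system, which takes a division by 2, gives ([cross_action])
      [2 [x, B y z] = B [x, y] z + B y [x, z] - B [y, z] x],
    and [[x', B y z]] obeys the same formula.  So the values of [B] span an ideal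
    on which [x] and [x'] act alike, whence [[B x y, B z w] = [[x, y], B z w]];
    antisymmetry of this bracket is the four-variable identity
    ([cross_relation])
      [B [[x,y],z] w + B z [[x,y],w] + B [[z,w],x] y + B x [[z,w],y] = 0].

    Let [a, b] generate [g], and say that combinations of iterated brackets of
    [k] of the generators have weight [k].  In [chi g], brackets add weights as
    long as [B u v] is given the sum of the weights of [u] and [v].  Elements of
    [g] of weight at least [c + 1] vanish, so the theorem reduces to the
    vanishing of [B x y] when [x] and [y] have weights adding up to some
    [n >= c + 2].

    That is [B_homogeneous_eq0], a statement about alternating bilinear maps on
    [g] subject to the four-variable identity.  Elements of weight [n - 1] are
    zero, so [B] kills the pairs of weights [(1, n - 1)], and the identity
    with [x], [z] of weight 1 becomes [B [z,[x,y]] w = B y [x,[z,w]]].  This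
    moves weight from one side to the other by steps of 2, so all pairs with
    an odd weight are killed too.  There remain the pairs of even weights, for
    even [n].
    There [B] is an invariant alternating form on the part of even weight; the
    trilinear map [B [s, y] w] is then antisymmetric in [s, y] and symmetric
    in [y, w], hence zero as 2 is invertible.
    So, inside [B], the operators [ad z] and [ad x] with [x], [z] odd may be
    exchanged in [B [z,[x,y]] w]; with some more work
    ([B_odd_bracket_eq0]) all products [ad z \o ad x] with [x], [z] of weight 1
    commute and are self-adjoint.  As two generators have, up to scalars, the
    single bracket [t = [a, b]], everything reduces to [B (W t) t] with [W] a
    product of such operators, and
      [B (W t) t = B t (W t) = - B (W t) t]. *)

(** * Lie algebras and their homomorphisms *)

Section LieBasics.
Context (K : fieldType) (L : lieAlgType K).
Implicit Types x y z : L.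

Lemma lieDl x y z : [lie x + y, z] = [lie x, z] + [lie y, z].
Proof. by have := lie_linearl z 1 x y; rewrite /= !scale1r. Qed.

Lemma lieDr x y z : [lie z, x + y] = [lie z, x] + [lie z, y].
Proof. by have := lie_linearr z 1 x y; rewrite /= !scale1r. Qed.

Lemma lie0l x : [lie 0, x] = 0.
Proof. by apply: (addrI [lie 0, x]); rewrite -lieDl !addr0. Qed.

Lemma lie0r x : [lie x, 0] = 0.
Proof. by apply: (addrI [lie x, 0]); rewrite -lieDr !addr0. Qed.

Lemma lieC x y : [lie x, y] = - [lie y, x].
Proof.
apply/eqP; rewrite -addr_eq0; apply/eqP.
by have := liexx (x + y); rewrite lieDl !lieDr !liexx add0r addr0.
Qed.

Lemma lieZl k x y : [lie k *: x, y] = k *: [lie x, y].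
Proof. by have := lie_linearl y k x 0; rewrite /= !addr0 lie0l addr0. Qed.

Lemma lieZr k x y : [lie y, k *: x] = k *: [lie y, x].
Proof. by have := lie_linearr y k x 0; rewrite /= !addr0 lie0r addr0. Qed.

Lemma lieNr x y : [lie y, - x] = - [lie y, x].
Proof. by rewrite -scaleN1r lieZr scaleN1r. Qed.

Lemma lieBr x y z : [lie z, x - y] = [lie z, x] - [lie z, y].
Proof. by rewrite lieDr lieNr. Qed.

Lemma lie_derivation x y z :
  [lie x, [lie y, z]] = [lie [lie x, y], z] + [lie y, [lie x, z]].
Proof.
have := lie_jacobi x y z.
rewrite (lieC z [lie x, y]) (lieC z x) lieNr => /eqP.
by rewrite subr_eq0 subr_eq => /eqP.
Qed.

Lemma lie_lieE x y z :
  [lie [lie x, y], z] = [lie x, [lie y, z]] - [lie y, [lie x, z]].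
Proof. by rewrite lie_derivation addrK. Qed.

End LieBasics.

Section LieHom.
Context (K : fieldType) (L M : lieAlgType K) (f : L -> M).
Hypothesis f_hom : is_lie_hom f.

Lemma lie_homD x y : f (x + y) = f x + f y.
Proof. by rewrite -[x]scale1r f_hom.1 !scale1r. Qed.

Lemma lie_hom0 : f 0 = 0.
Proof. by apply: (addrI (f 0)); rewrite -lie_homD !addr0. Qed.

Lemma lie_homN x : f (- x) = - f x.
Proof. by apply: (addIr (f x)); rewrite -lie_homD !addNr lie_hom0. Qed.

End LieHom.

Lemma is_lie_hom_comp (K : fieldType) (L1 L2 L3 : lieAlgType K)
    (f : L2 -> L3) (h : L1 -> L2) :
  is_lie_hom f -> is_lie_hom h -> is_lie_hom (f \o h).
Proof.
by move=> [fZD fL] [hZD hL]; split=> [r x y|x y] /=; rewrite ?hZD ?fZD ?hL ?fL.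
Qed.

Section CharacteristicNotTwo.
Context (K : fieldType) (hK : 2 \notin [pchar K]).

Lemma two_neq0 : (2 : K) != 0.
Proof. by apply/negP => two0; move: hK; rewrite inE /= two0. Qed.

Lemma double_inj (M : lmodType K) (u v : M) : u + u = v + v -> u = v.
Proof. by rewrite -!mulr2n -!scaler_nat => /(scalerI two_neq0). Qed.

Lemma eq_opp_eq0 (M : lmodType K) (u : M) : u = - u -> u = 0.
Proof. by move=> uN; apply: double_inj; rewrite {1}uN addNr addr0. Qed.

End CharacteristicNotTwo.

(** * Weights of elements of a two-generated Lie algebra *)

Section Homogeneous.
Context (K : fieldType) (g : lieAlgType K) (a b : g).

(** Weights count letters formally: relations may give an element several
    weights, and [g] need not be graded.  Right-normed words suffice by
    [homogeneous_lie], and they give an elimination principle that strips one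
    letter. *)
Inductive homogeneous : nat -> g -> Prop :=
| homogeneous0 k : homogeneous k 0
| homogeneousZD k (r : K) x y :
    homogeneous k x -> homogeneous k y -> homogeneous k (r *: x + y)
| homogeneous_gen1 : homogeneous 1 a
| homogeneous_gen2 : homogeneous 1 b
| homogeneous_ad z k y :
    homogeneous 1 z -> homogeneous k y -> homogeneous k.+1 [lie z, y].

Lemma homogeneousN k x : homogeneous k x -> homogeneous k (- x).
Proof.
move=> hx; rewrite -[- x]addr0 -scaleN1r; apply: homogeneousZD => //.
exact: homogeneous0.
Qed.

Lemma homogeneousB k x y :
  homogeneous k x -> homogeneous k y -> homogeneous k (x - y).
Proof.
by move=> hx /homogeneousN hy; rewrite -[x]scale1r; exact: homogeneousZD.
Qed.

Lemma homogeneous_lie i j x y :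
  homogeneous i x -> homogeneous j y -> homogeneous (i + j) [lie x, y].
Proof.
move=> hx; elim: hx j y => {i x}.
- by move=> i j y _; rewrite lie0l; exact: homogeneous0.
- move=> i r x1 x2 _ IH1 _ IH2 j y hy.
  by rewrite lieDl lieZl; apply: homogeneousZD; [exact: IH1|exact: IH2].
- by move=> j y; rewrite add1n; apply: homogeneous_ad; exact: homogeneous_gen1.
- by move=> j y; rewrite add1n; apply: homogeneous_ad; exact: homogeneous_gen2.
move=> z i x hz _ _ IH j y hy; rewrite lie_lieE addSn.
apply: homogeneousB; first by apply: homogeneous_ad => //; exact: IH.
by rewrite -addnS; apply: IH; exact: homogeneous_ad.
Qed.

Lemma homogeneous_weight0 x : homogeneous 0 x -> x = 0.
Proof.
move E: 0%N => k hx; elim: hx E => //.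
by move=> i r x1 x2 _ IH1 _ IH2 k0; rewrite IH1 ?IH2 // scaler0 addr0.
Qed.

Section Elimination.
Context (Q : g -> Prop).
Hypothesis Q0 : Q 0.
Hypothesis QZD : forall (r : K) x y, Q x -> Q y -> Q (r *: x + y).

Lemma homogeneous1_elim : Q a -> Q b -> forall x, homogeneous 1 x -> Q x.
Proof.
move=> Qa Qb x; move E: 1%N => k hx; elim: hx E => //.
- by move=> i r x1 x2 _ IH1 _ IH2 E; apply: QZD; [exact: IH1|exact: IH2].
- move=> z [|//] y _ _ + _ _ => /homogeneous_weight0 ->.
  by rewrite lie0r.
Qed.

Lemma homogeneousS_elim k :
    (forall z y, homogeneous 1 z -> homogeneous k.+1 y -> Q [lie z, y]) ->
  forall x, homogeneous k.+2 x -> Q x.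
Proof.
move=> Qad x; move E: k.+2 => m hx; elim: hx E => //.
- by move=> i r x1 x2 _ IH1 _ IH2 E; apply: QZD; [exact: IH1|exact: IH2].
- by move=> z m' y hz _ hy _ [E]; apply: Qad; rewrite // E.
Qed.

End Elimination.

(** With three generators the elements of weight 2 would need three brackets
    instead of one, and the concluding argument, which compares [B (W t) t]
    with its opposite for a single [t], would break down. *)
Lemma homogeneous2_elim x :
  homogeneous 2 x -> exists r : K, x = r *: [lie a, b].
Proof.
pose Q0 u := exists r : K, u = r *: [lie a, b].
move=> hx; apply: (homogeneousS_elim (Q := Q0) _ _ _ hx); rewrite /Q0.
- by exists 0; rewrite scale0r.
- by move=> r _ _ [r1 ->] [r2 ->]; exists (r * r1 + r2);
    rewrite scalerDl scalerA.
move=> z y hz hy.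
pose Q1 u := exists r : K, [lie a, u] = r *: [lie a, b].
pose Q2 u := exists r : K, [lie b, u] = r *: [lie a, b].
pose Q3 u := exists r : K, [lie u, y] = r *: [lie a, b].
have h1 : Q1 y.
  apply: homogeneous1_elim hy; rewrite /Q1.
  - by exists 0; rewrite lie0r scale0r.
  - by move=> r u v [r1 e1] [r2 e2]; exists (r * r1 + r2);
      rewrite lieDr lieZr e1 e2 scalerDl scalerA.
  - by exists 0; rewrite liexx scale0r.
  - by exists 1; rewrite scale1r.
have h2 : Q2 y.
  apply: homogeneous1_elim hy; rewrite /Q2.
  - by exists 0; rewrite lie0r scale0r.
  - by move=> r u v [r1 e1] [r2 e2]; exists (r * r1 + r2);
      rewrite lieDr lieZr e1 e2 scalerDl scalerA.
  - by exists (-1); rewrite lieC scaleN1r.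
  - by exists 0; rewrite liexx scale0r.
apply: (homogeneous1_elim (Q := Q3)) hz => //; rewrite /Q3.
- by exists 0; rewrite lie0l scale0r.
- by move=> r u v [r1 e1] [r2 e2]; exists (r * r1 + r2);
    rewrite lieDl lieZl e1 e2 scalerDl scalerA.
Qed.

End Homogeneous.

(** * The lower central series *)

Section LowerCentralSeries.
Context (K : fieldType) (L : lieAlgType K).

Lemma is_submodule_lcs k : is_submodule (@lcs K L k).
Proof.
case: k => [|k] /=; first by split.
split=> [S [[S0 _] _] //|r x y hx hy S hS].
by apply: hS.1.2; [exact: hx|exact: hy].
Qed.

Lemma lcs0_weaken i j (x : L) : lcs i = [set 0 : L] -> (i <= j)%N ->
  lcs j x -> x = 0.
Proof.
move=> lcsi; elim: j x => [|j IH] x.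
  by rewrite leqn0 => /eqP i0; rewrite -i0 lcsi.
rewrite leq_eqVlt => /orP[/eqP <-|ij]; first by rewrite lcsi.
move=> /(_ [set 0]); apply; split.
  by split=> [//|r u v -> ->]; rewrite /= scaler0 addr0.
by move=> _ [u [v [/(IH _ ij) -> ->]]]; rewrite /= lie0l.
Qed.

Lemma homogeneous_lcs (a b : L) k x : homogeneous a b k.+1 x -> lcs k x.
Proof.
elim: k x => [//|k IH] x.
have [sub0 subZD] := is_submodule_lcs k.+1.
apply: homogeneousS_elim => // z y hz /IH hy.
rewrite lieC -[- _]addr0 -scaleN1r; apply: subZD => // S [_]; apply.
by exists y, z.
Qed.

Lemma nilpotent_of_class_le m : lcs m = [set 0 : L] ->
  exists2 d, nilpotent_of_class L d & (d <= m)%N.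
Proof.
move=> lcsm; have ex : exists k, `[< lcs k = [set 0 : L] >].
  by exists m; apply/asboolP.
case: (ex_minnP ex) => d /asboolP lcsd dmin; exists d.
  by split=> // k /asboolP; exact: dmin.
by apply: dmin; apply/asboolP.
Qed.

End LowerCentralSeries.

(** * Alternating maps satisfying the four-variable identity *)

Section Form.
Context (K : fieldType) (hK : 2 \notin [pchar K]).

Context (g : lieAlgType K) (M : lmodType K) (B : g -> g -> M).
Hypothesis B_linearl : forall y, linear (B^~ y).
Hypothesis BC : forall x y, B x y = - B y x.
Hypothesis B_crossed : forall x y z w,
  B [lie [lie x, y], z] w + B z [lie [lie x, y], w]
  + B [lie [lie z, w], x] y + B x [lie [lie z, w], y] = 0.

Lemma BZDl r x y w : B (r *: x + y) w = r *: B x w + B y w.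
Proof. exact: (B_linearl w r x y). Qed.

Lemma BDl x y w : B (x + y) w = B x w + B y w.
Proof. by rewrite -[x]scale1r BZDl !scale1r. Qed.

Lemma B0l w : B 0 w = 0.
Proof. by apply: (addrI (B 0 w)); rewrite -BDl !addr0. Qed.

Lemma BNl x w : B (- x) w = - B x w.
Proof. by apply: (addIr (B x w)); rewrite -BDl !addNr B0l. Qed.

Lemma BBl x y w : B (x - y) w = B x w - B y w.
Proof. by rewrite BDl BNl. Qed.

Lemma B0r w : B w 0 = 0. Proof. by rewrite BC B0l oppr0. Qed.

Lemma BBr x y w : B w (x - y) = B w x - B w y.
Proof. by rewrite BC BBl (BC x) (BC y) opprD !opprK. Qed.

Lemma BZDr r x y w : B w (r *: x + y) = r *: B w x + B w y.
Proof. by rewrite BC BZDl opprD -scalerN -!BC. Qed.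

Lemma BZl r x w : B (r *: x) w = r *: B x w.
Proof. by rewrite -[r *: x]addr0 BZDl B0l addr0. Qed.

(** Two of the four terms of the identity are hypotheses here; they get killed
    later by considerations of weight. *)
Lemma B_move z x y w :
    B z [lie [lie x, y], w] = 0 -> B x [lie [lie z, w], y] = 0 ->
  B [lie z, [lie x, y]] w = B y [lie x, [lie z, w]].
Proof.
move=> e1 e2; have := B_crossed x y z w.
rewrite e1 e2 !addr0 (lieC [lie x, y]) (lieC [lie z, w]) !BNl => /eqP.
by rewrite subr_eq0 (BC y) => /eqP <-; rewrite opprK.
Qed.

Context (a b : g) (n : nat).
Notation H := (homogeneous a b).
Hypothesis H_top : forall x, H n.-1 x -> x = 0.

Lemma homogeneous_cast i j x : H i x -> i = j -> H j x.
Proof. by move=> hx <-. Qed.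

Ltac hom := eapply homogeneous_cast;
  [repeat first [eassumption | eapply homogeneous_lie]|lia].
Ltac wt := first [eassumption | lia | hom].

Lemma B_gen_eq0 z x : H 1 z -> H n.-1 x -> B z x = 0.
Proof. by move=> _ /H_top ->; exact: B0r. Qed.

Lemma B_move_gen i j z x y w :
    H 1 z -> H 1 x -> H i y -> H j w -> (i + j).+2 = n ->
  B [lie z, [lie x, y]] w = B y [lie x, [lie z, w]].
Proof. by move=> *; apply: B_move; apply: B_gen_eq0 => //; hom. Qed.

(** Each step moves two letters to the other side; an odd weight ends up at 1,
    against a factor of weight [n - 1]. *)
Lemma B_odd_eq0 i j x y : H i.*2.+1 x -> H j y -> (i.*2.+1 + j)%N = n -> B x y = 0.
Proof.
elim: i j x y => [|i IH] j x y hx hy ijn.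
  by apply: B_gen_eq0 => //; hom.
pose Q u := B u y = 0; rewrite doubleS in hx ijn.
apply: (homogeneousS_elim (Q := Q) _ _ _ hx); rewrite /Q.
- exact: B0l.
- by move=> r u v u0 v0; rewrite BZDl u0 v0 scaler0 addr0.
move=> z v hz hv.
pose Q' u := B [lie z, u] y = 0.
apply: (homogeneousS_elim (Q := Q') _ _ _ hv); rewrite /Q'.
- by rewrite lie0r B0l.
- by move=> r u1 u2 e1 e2; rewrite lieDr lieZr BZDl e1 e2 scaler0 addr0.
move=> x' u hx' hu; rewrite (@B_move_gen i.*2.+1 j) //.
by apply: (IH j.+2) => //; [hom|lia].
Qed.

Lemma B_odd_eq0r i j x y :
  H i x -> H j.*2.+1 y -> (i + j.*2.+1)%N = n -> B x y = 0.
Proof.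
by move=> hx hy ijn; rewrite BC (B_odd_eq0 hy hx) ?oppr0 // addnC.
Qed.

(** ** Pairs of even weights *)

Lemma B_move_odd k l i j z x y w :
    H k.*2.+1 z -> H l.*2.+1 x -> H i.*2 y -> H j.*2 w ->
    (k + l + i + j).+1.*2 = n ->
  B [lie z, [lie x, y]] w = B y [lie x, [lie z, w]].
Proof.
move=> *; apply: B_move.
  by apply: (@B_odd_eq0 k (l + i + j).*2.+1); [hom|hom|lia].
by apply: (@B_odd_eq0 l (k + i + j).*2.+1); [hom|hom|lia].
Qed.

Lemma B_invariant k l i j x z y w :
    H k.*2.+1 x -> H l.*2.+1 z -> H i.*2 y -> H j.*2 w ->
    (k + l + i + j).+1.*2 = n ->
  B [lie [lie x, z], y] w = - B y [lie [lie x, z], w].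
Proof.
move=> hx hz hy hw E; rewrite !lie_lieE BBl BBr opprB.
by congr (_ - _); apply: B_move_odd; try eassumption; lia.
Qed.

(** An element of positive even weight is a combination of brackets of a letter
    with an element of odd weight. *)
Lemma B_even_invariant k i j s y w :
    H k.*2 s -> H i.*2 y -> H j.*2 w -> (k + i + j).*2 = n ->
  B [lie s, y] w = - B y [lie s, w].
Proof.
case: k => [|k] hs hy hw E.
  by rewrite (homogeneous_weight0 hs) !lie0l B0l B0r oppr0.
pose Q u := B [lie u, y] w = - B y [lie u, w].
rewrite doubleS in hs; apply: (homogeneousS_elim (Q := Q) _ _ _ hs); rewrite /Q.
- by rewrite !lie0l B0l B0r oppr0.
- move=> r u v e1 e2; rewrite !lieDl !lieZl BZDl e1 e2.
  by rewrite BZDr scalerN opprD.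
move=> z x hz hx; apply: (@B_invariant 0 k) ; wt.
Qed.

(** By invariance the trilinear map is symmetric in its last two arguments; it is
    antisymmetric in its first two.  The braid relation between these two
    transpositions then equates the map with its opposite. *)
Lemma B_even_bracket_eq0 k i j s y w :
    H k.*2 s -> H i.*2 y -> H j.*2 w -> (k + i + j).*2 = n ->
  B [lie s, y] w = 0.
Proof.
move=> hs hy hw E; apply: (eq_opp_eq0 hK).
have swap23 k' i' j' s' y' w' : H k'.*2 s' -> H i'.*2 y' -> H j'.*2 w' ->
    (k' + i' + j').*2 = n -> B [lie s', y'] w' = B [lie s', w'] y'.
  by move=> hs' hy' hw' E'; rewrite (B_even_invariant hs' hy' hw' E') -BC.
have swap12 s' y' w' : B [lie s', y'] w' = - B [lie y', s'] w'.
  by rewrite lieC BNl.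
rewrite {1}(swap23 k i j s y w) // swap12 (swap23 j k i w s y) //; try wt.
by rewrite swap12 opprK (swap23 i j k y w s) //; wt.
Qed.

Lemma B_odd_sym k l i j z x y w :
    H k.*2.+1 z -> H l.*2.+1 x -> H i.*2 y -> H j.*2 w ->
    (k + l + i + j).+1.*2 = n ->
  B [lie z, [lie x, y]] w = B [lie x, [lie z, y]] w.
Proof.
move=> hz hx hy hw E; apply/eqP; rewrite -subr_eq0 -BBl -lie_lieE.
apply/eqP; apply: (@B_even_bracket_eq0 (k + l).+1 i j) ; wt.
Qed.

Lemma B_odd_selfadjoint k l i j z x y w :
    H k.*2.+1 z -> H l.*2.+1 x -> H i.*2 y -> H j.*2 w ->
    (k + l + i + j).+1.*2 = n ->
  B [lie z, [lie x, y]] w = B y [lie z, [lie x, w]].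
Proof.
move=> hz hx hy hw E; rewrite (B_odd_sym hz hx hy hw) //.
by apply: B_move_odd; wt.
Qed.

Lemma B_odd_bracket_alternating k l p q j r x s z w :
    H k.*2 r -> H l.*2.+1 x -> H p.*2 s -> H q.*2.+1 z -> H j.*2 w ->
    (k + l + p + q + j).+1.*2 = n ->
  B [lie [lie r, x], [lie s, z]] w = - B [lie [lie r, x], [lie w, z]] s.
Proof.
move=> hr hx hs hz hw E.
have hrx : H (k + l).*2.+1 [lie r, x] by hom.
rewrite (lieC s) (lieC w) !lieNr !BNl opprK.
rewrite (B_odd_selfadjoint hrx hz hs hw); try wt.
by rewrite BC opprK.
Qed.

(** Fix [x] and [z].  Exchanging the two brackets, which moves [x] and [z] as
    well, and [B_odd_bracket_alternating] generate antisymmetry in all of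
    [r, s, w].  On the other hand the value at [(r, s)] minus the value at
    [(s, r)] involves [[r, s]] only, and vanishes by
    [B_even_bracket_eq0]. *)
Lemma B_odd_bracket_eq0 k l p q j r x s z w :
    H k.*2 r -> H l.*2.+1 x -> H p.*2 s -> H q.*2.+1 z -> H j.*2 w ->
    (k + l + p + q + j).+1.*2 = n ->
  B [lie [lie r, x], [lie s, z]] w = 0.
Proof.
move=> hr hx hs hz hw E.
have flip r' x' s' z' w' :
    B [lie [lie r', x'], [lie s', z']] w' = - B [lie [lie s', z'], [lie r', x']] w'.
  by rewrite lieC BNl.
have swap : B [lie [lie s, x], [lie r, z]] w
          = - B [lie [lie r, x], [lie s, z]] w.
  rewrite (B_odd_bracket_alternating hs hx hr hz hw); try wt.
  rewrite (flip s) (B_odd_bracket_alternating hw hz hs hx hr); try wt.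
  by rewrite opprK (flip w) opprK (B_odd_bracket_alternating hr hx hw hz hs); try wt.
have nest k' p' r' s' : H k'.*2 r' -> H p'.*2 s' ->
    (k' + l + p' + q + j).+1.*2 = n ->
    B [lie [lie r', x], [lie s', z]] w = B [lie z, [lie s', [lie r', x]]] w.
  move=> hr' hs' E'; rewrite (lieC s' z) (lieC s' [lie r', x]) !lieNr !BNl.
  congr (- _); apply: (@B_odd_sym (k' + l) q p' j); wt.
have comm0 : B [lie z, [lie [lie r, s], x]] w = 0.
  rewrite (lieC _ x) lieNr BNl (B_move_odd (k := q) (l := l) (i := k + p) (j := j)) //;
    try wt.
  rewrite (B_even_bracket_eq0 (k := k) (i := p) (j := (l + q + j).+1)) ?oppr0 //; wt.
apply: (eq_opp_eq0 hK); rewrite -swap (nest k p) // (nest p k) //; try wt.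
by move: comm0; rewrite lie_lieE lieBr BBl => /eqP; rewrite subr_eq0 => /eqP.
Qed.

(** ** Words in the adjoint operators of the generators *)

Definition ad2 (p : g * g) (y : g) : g := [lie p.1, [lie p.2, y]].

(** Four adjacent transpositions of letters exchange the two operators.  Those
    inside a pair leave an error that is zero by [B_even_bracket_eq0]; for those
    across the two pairs, the error is zero by [B_odd_bracket_eq0]. *)
Lemma B_ad2_comm j i p q y w :
    H 1 p.1 -> H 1 p.2 -> H 1 q.1 -> H 1 q.2 -> H i.*2 y -> H j.*2 w ->
    (i + j).+2.*2 = n ->
  B (ad2 p (ad2 q y)) w = B (ad2 q (ad2 p y)) w.
Proof.
case: p q => z x [z' x'] /= hz hx hz' hx' hy hw E; rewrite /ad2 /=.
have outer u v t : H 1 u -> H 1 v -> H i.+1.*2 t ->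
    B [lie u, [lie v, t]] w = B [lie v, [lie u, t]] w.
  by move=> hu hv ht; apply: (@B_odd_sym 0 0 i.+1 j); wt.
have inner u v s t : H 1 u -> H 1 v -> H 1 s -> H 1 t ->
    B [lie u, [lie v, [lie s, [lie t, y]]]] w
    = B [lie u, [lie v, [lie t, [lie s, y]]]] w.
  move=> hu hv hs ht; apply/eqP; rewrite -subr_eq0 -BBl -!lieBr -lie_lieE.
  rewrite (@B_odd_selfadjoint 0 0 i.+1 j) //; try wt.
  by rewrite (@B_even_bracket_eq0 1 i j.+1) //; wt.
have middle u v s t : H 1 u -> H 1 v -> H 1 s -> H 1 t ->
    B [lie u, [lie v, [lie s, [lie t, y]]]] w
    = B [lie u, [lie s, [lie v, [lie t, y]]]] w.
  move=> hu hv hs ht; apply/eqP; rewrite -subr_eq0 -BBl -!lieBr -lie_lieE.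
  have hvs : H 1.*2 [lie v, s] by hom.
  have hyt : H i.*2.+1 [lie y, t] by hom.
  apply/eqP; rewrite (lieC t) lieNr (lieC _ [lie y, t]) !lieNr !BNl !opprK.
  rewrite (@B_odd_sym 0 i 1 j) //; try wt.
  by rewrite (lieC u) lieNr BNl (@B_odd_bracket_eq0 i 0 1 0 j) ?oppr0 //; wt.
have hxx'y : H i.+1.*2 [lie x, [lie x', y]] by hom.
by rewrite (middle z x) // (outer z z') // (inner z' z) // (middle z' z).
Qed.

Inductive even_word : nat -> (g -> g) -> Prop :=
| even_word0 : even_word 0 id
| even_wordS k p W : H 1 p.1 -> H 1 p.2 -> even_word k W ->
    even_word k.+1 (ad2 p \o W).

Lemma homogeneous_ad2 p i y : H 1 p.1 -> H 1 p.2 -> H i.*2 y ->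
  H i.+1.*2 (ad2 p y).
Proof. by move=> h1 h2 hy; rewrite /ad2; hom. Qed.

Lemma homogeneous_even_word k W i y : even_word k W -> H i.*2 y ->
  H (k + i).*2 (W y).
Proof.
by move=> hW hy; elim: hW => {k W} [//|k p W h1 h2 _ IH]; exact: homogeneous_ad2.
Qed.

Lemma B_ad2_selfadjoint i j p y w :
    H 1 p.1 -> H 1 p.2 -> H i.*2 y -> H j.*2 w -> (i + j).+1.*2 = n ->
  B (ad2 p y) w = B y (ad2 p w).
Proof. by move=> h1 h2 hy hw E; apply: (@B_odd_selfadjoint 0 0 i j); wt. Qed.

(** The word is peeled from the outside: its outer factor is moved to the right
    argument, the induction applies, and the factor is moved back. *)
Lemma B_even_word_comm k W i j p y w :
    even_word k W -> H 1 p.1 -> H 1 p.2 -> H i.*2 y -> H j.*2 w ->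
    (k + i + j).+1.*2 = n ->
  B (W (ad2 p y)) w = B (ad2 p (W y)) w.
Proof.
move=> hW h1 h2 hy; elim: hW j w => {k W} [//|k q W h3 h4 hW IH] j w hw E /=.
have hWy := homogeneous_even_word hW hy.
have hWpy := homogeneous_even_word hW (homogeneous_ad2 h1 h2 hy).
have hqw := homogeneous_ad2 h3 h4 hw.
rewrite (B_ad2_selfadjoint h3 h4 hWpy hw); last lia.
rewrite (IH _ _ hqw); last lia.
rewrite -(B_ad2_selfadjoint h3 h4 (homogeneous_ad2 h1 h2 hWy) hw); last lia.
by apply: B_ad2_comm h3 h4 h1 h2 hWy hw _; lia.
Qed.

Lemma B_even_word_selfadjoint k W i j y w :
    even_word k W -> H i.*2 y -> H j.*2 w -> (k + i + j).*2 = n ->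
  B (W y) w = B y (W w).
Proof.
move=> hW hy; elim: hW j w => {k W} [//|k p W h1 h2 hW IH] j w hw E /=.
have hWy := homogeneous_even_word hW hy.
rewrite (B_ad2_selfadjoint h1 h2 hWy hw); last lia.
rewrite (IH _ _ (homogeneous_ad2 h1 h2 hw)); last lia.
by rewrite BC (B_even_word_comm hW h1 h2 hw hy) -?BC //; lia.
Qed.

Lemma homogeneous_even_elim (Q : g -> Prop) i :
    Q 0 -> (forall (r : K) x y, Q x -> Q y -> Q (r *: x + y)) ->
    (forall p y, H 1 p.1 -> H 1 p.2 -> H i.*2.+1.+1 y -> Q (ad2 p y)) ->
  forall x, H i.*2.+4 x -> Q x.
Proof.
move=> Q0 QZD Qad; apply: homogeneousS_elim => // z y hz.
apply: (homogeneousS_elim (Q := fun u => Q [lie z, u])) => [|r u v|x u hx hu].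
- by rewrite lie0r.
- by rewrite lieDr lieZr; exact: QZD.
- exact: (Qad (z, x)).
Qed.

(** Letters of [w] are moved onto [W] until [w] is a multiple of [[a, b]]; then
    self-adjointness of [W] and antisymmetry of [B] show that the value is
    its own opposite. *)
Lemma B_even_word_gen_eq0 k W i w :
    even_word k W -> H i.+1.*2 w -> (k + i).+2.*2 = n ->
  B (W [lie a, b]) w = 0.
Proof.
have hab : H 1.*2 [lie a, b].
  by apply: homogeneous_ad; constructor.
elim: i k W w => [|i IH] k W w hW hw E.
  have [r ->] := homogeneous2_elim hw.
  rewrite BC BZl -scalerN -BC (eq_opp_eq0 hK (u := B _ _)) ?scaler0 //.
  by rewrite {1}(B_even_word_selfadjoint hW hab hab) -?BC //; lia.
apply: (homogeneous_even_elim (Q := fun u => B (W [lie a, b]) u = 0) _ _ _ hw).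
- exact: B0r.
- by move=> r u v e1 e2; rewrite BZDr e1 e2 scaler0 addr0.
move=> p y h1 h2 hy; have hWt := homogeneous_even_word hW hab.
rewrite -(B_ad2_selfadjoint (j := i.+1) h1 h2 hWt hy); last lia.
by apply: (IH k.+1 (ad2 p \o W)); [exact: even_wordS|exact: hy|lia].
Qed.

Lemma B_even_eq0 i j x y :
    H i.+1.*2 x -> H j.+1.*2 y -> (i + j).+2.*2 = n -> B x y = 0.
Proof.
elim: i j x y => [|i IH] j x y hx hy E.
  have [r ->] := homogeneous2_elim hx.
  rewrite BZl (B_even_word_gen_eq0 even_word0 hy) ?scaler0 //; lia.
apply: (homogeneous_even_elim (Q := fun u => B u y = 0) _ _ _ hx).
- exact: B0l.
- by move=> r u v e1 e2; rewrite BZDl e1 e2 scaler0 addr0.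
move=> p u h1 h2 hu.
rewrite (B_ad2_selfadjoint (i := i.+1) h1 h2 hu hy); last lia.
by apply: (IH j.+1); [exact: hu|exact: homogeneous_ad2|lia].
Qed.

(** ** All pairs of weights *)

Lemma B_homogeneous_eq0 i j x y :
  H i x -> H j y -> (i + j)%N = n -> B x y = 0.
Proof.
rewrite -[i]odd_double_half -[j]odd_double_half.
case: (odd i) => hx hy E; first exact: B_odd_eq0 hx hy E.
case: (odd j) hy E => hy E; first exact: B_odd_eq0r hx hy E.
rewrite !add0n in hx hy E.
case: i./2 hx E => [|k] hx E; first by rewrite (homogeneous_weight0 hx) B0l.
case: j./2 hy E => [|l] hy E; first by rewrite (homogeneous_weight0 hy) B0r.
by apply: B_even_eq0 hx hy _; lia.
Qed.

End Form.

(** * Two weakly commuting copies of a Lie algebra *)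

Section HalvedAction.
Context (K : fieldType) (g L : lieAlgType K) (f1 f2 : g -> L).
Hypotheses (f1_hom : is_lie_hom f1) (f2_hom : is_lie_hom f2).
Hypothesis f12_comm : forall x, [lie f1 x, f2 x] = 0.

Lemma cross_lieC x y : [lie f1 x, f2 y] = - [lie f1 y, f2 x].
Proof.
apply/eqP; rewrite -addr_eq0; apply/eqP.
have := f12_comm (x + y).
by rewrite (lie_homD f1_hom) (lie_homD f2_hom) lieDl !lieDr !f12_comm add0r addr0.
Qed.

Lemma cross_lieCC x y : [lie f2 x, f1 y] = [lie f1 x, f2 y].
Proof. by rewrite lieC [RHS]cross_lieC. Qed.

(** The derivation rule expresses each of the three cyclic rotations of
    [[f1 x, [f1 y, f2 z]]] by the next one with a minus sign; going once
    around gives minus the initial term. *)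
Lemma double_cross_action x y z :
  [lie f1 x, [lie f1 y, f2 z]] + [lie f1 x, [lie f1 y, f2 z]]
  = [lie f1 [lie x, y], f2 z] + [lie f1 y, f2 [lie x, z]]
    - [lie f1 [lie y, z], f2 x].
Proof.
have step u v w : [lie f1 u, [lie f1 v, f2 w]]
    = [lie f1 [lie u, v], f2 w] - [lie f1 v, [lie f1 w, f2 u]].
  by rewrite lie_derivation f1_hom.2 (cross_lieC u) lieNr.
have loop : [lie f1 x, [lie f1 y, f2 z]] = [lie f1 [lie x, y], f2 z]
    - ([lie f1 [lie y, z], f2 x]
       - ([lie f1 [lie z, x], f2 y] - [lie f1 x, [lie f1 y, f2 z]])).
  by rewrite -(step z x y) -(step y z x) -step.
have -> : [lie f1 y, f2 [lie x, z]] = [lie f1 [lie z, x], f2 y].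
  by rewrite (lieC x z) (lie_homN f2_hom) lieNr -cross_lieC.
by rewrite {1}loop opprB [X in _ + X + _]addrAC addrA addrNK addrA.
Qed.

End HalvedAction.

Section WeakCommutativity.
Context (K : fieldType) (hK : 2 \notin [pchar K]) (g L : lieAlgType K).
Context (f1 f2 : g -> L).
Hypotheses (f1_hom : is_lie_hom f1) (f2_hom : is_lie_hom f2).
Hypothesis f12_comm : forall x, [lie f1 x, f2 x] = 0.

Let B x y := [lie f1 x, f2 y].

Lemma f21_comm x : [lie f2 x, f1 x] = 0.
Proof. by rewrite lieC f12_comm oppr0. Qed.

Lemma cross_action x y z :
  [lie f1 x, B y z] = 2^-1 *: (B [lie x, y] z + B y [lie x, z] - B [lie y, z] x).
Proof.
rewrite -(double_cross_action f1_hom f2_hom f12_comm) -mulr2n -scaler_nat.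
by rewrite scalerA mulVf ?scale1r // (two_neq0 hK).
Qed.

(** Exchanging the two copies does not change the right-hand side of
    [double_cross_action], because [[f2 y, f1 z] = [f1 y, f2 z]]. *)
Lemma cross_action_copy x y z : [lie f2 x, B y z] = [lie f1 x, B y z].
Proof.
apply: (double_inj hK); rewrite (double_cross_action f1_hom f2_hom f12_comm).
rewrite /B -(cross_lieCC f1_hom f2_hom f12_comm y z).
rewrite (double_cross_action f2_hom f1_hom f21_comm).
by rewrite !(cross_lieCC f1_hom f2_hom f12_comm).
Qed.

Lemma cross_action_copy2 u x y z :
  [lie f2 u, [lie f1 x, B y z]] = [lie f1 u, [lie f1 x, B y z]].
Proof.
by rewrite cross_action !lieZr !lieBr !lieDr !cross_action_copy.
Qed.

Lemma cross_lie_cross x y z w : [lie B x y, B z w] = [lie f1 [lie x, y], B z w].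
Proof.
by rewrite {1}/B lie_lieE cross_action_copy2 cross_action_copy -lie_lieE f1_hom.2.
Qed.

Lemma crossC x y : B x y = - B y x.
Proof. exact: (cross_lieC f1_hom f2_hom f12_comm). Qed.

Lemma cross_linearl y : linear (B^~ y).
Proof. by move=> r u v; rewrite /B f1_hom.1 lieDl lieZl. Qed.

(** Both sides of the antisymmetry of [[B x y, B z w]] are computed with
    [cross_lie_cross]; the terms [B [z, w] [x, y]] and [B [x, y] [z, w]] cancel. *)
Lemma cross_relation x y z w :
  B [lie [lie x, y], z] w + B z [lie [lie x, y], w]
  + B [lie [lie z, w], x] y + B x [lie [lie z, w], y] = 0.
Proof.
have := lieC (B x y) (B z w); rewrite !cross_lie_cross !cross_action -scalerN.
have two_inv : (2 : K)^-1 != 0 by rewrite invr_eq0 (two_neq0 hK).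
move=> /(scalerI two_inv) /eqP.
by rewrite -addr_eq0 (crossC [lie z, w]) opprK addrACA addrN addr0 addrA => /eqP.
Qed.

Context (a b : g) (c : nat).
Notation H := (homogeneous a b).
Hypothesis H_top : forall k x, (c < k)%N -> H k x -> x = 0.

Lemma cross_homogeneous_eq0 i j x y :
  (c.+1 < i + j)%N -> H i x -> H j y -> B x y = 0.
Proof.
move=> lt hx hy; apply: (B_homogeneous_eq0 hK cross_linearl crossC
  cross_relation _ hx hy erefl) => u.
by apply: H_top; lia.
Qed.

(** A descending filtration of the subalgebra generated by the two copies: it is
    compatible with brackets, hence contains the lower central series. *)
Inductive filtration k : L -> Prop :=
| filtration0 : filtration k 0
| filtrationZD (r : K) x y :
    filtration k x -> filtration k y -> filtration k (r *: x + y)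
| filtration_f1 i u : (k <= i)%N -> H i u -> filtration k (f1 u)
| filtration_f2 i u : (k <= i)%N -> H i u -> filtration k (f2 u)
| filtration_cross i j u v : (k <= i + j)%N -> H i u -> H j v ->
    filtration k (B u v).

Lemma filtrationD k x y :
  filtration k x -> filtration k y -> filtration k (x + y).
Proof. by move=> hx hy; rewrite -[x]scale1r; exact: filtrationZD. Qed.

Lemma filtrationZ k r x : filtration k x -> filtration k (r *: x).
Proof.
by move=> hx; rewrite -[_ *: x]addr0; apply: filtrationZD => //; exact: filtration0.
Qed.

Lemma filtrationN k x : filtration k x -> filtration k (- x).
Proof. by move=> hx; rewrite -scaleN1r; exact: filtrationZ. Qed.

Lemma filtration_act_cross m i j k u v w :
    H i u -> H j v -> H k w -> (m <= i + (j + k))%N ->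
  filtration m [lie f1 u, B v w].
Proof.
move=> hu hv hw le; rewrite cross_action; apply: filtrationZ.
have [huv huw hvw] := And3 (homogeneous_lie hu hv) (homogeneous_lie hu hw)
  (homogeneous_lie hv hw).
apply: filtrationD; first apply: filtrationD; last apply: filtrationN.
- by apply: (filtration_cross _ huv hw); lia.
- by apply: (filtration_cross _ hv huw); lia.
- by apply: (filtration_cross _ hvw hu); lia.
Qed.

Lemma filtration_act i k u x : H i u -> filtration k x ->
  filtration (i + k) [lie f1 u, x] /\ filtration (i + k) [lie f2 u, x].
Proof.
move=> hu; elim=> {x}.
- by rewrite !lie0r; split; exact: filtration0.
- by move=> r x y _ [h1 h2] _ [h3 h4]; rewrite !lieDr !lieZr;
    split; exact: filtrationZD.
- move=> j v le hv; split.
    rewrite -f1_hom.2; apply: (filtration_f1 _ (homogeneous_lie hu hv)); lia.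
  rewrite (cross_lieCC f1_hom f2_hom f12_comm).
  by apply: (filtration_cross _ hu hv); lia.
- move=> j v le hv; split; first by apply: (filtration_cross _ hu hv); lia.
  rewrite -f2_hom.2; apply: (filtration_f2 _ (homogeneous_lie hu hv)); lia.
- move=> j l v w le hv hw; rewrite cross_action_copy.
  by split; apply: (filtration_act_cross hu hv hw); lia.
Qed.

Lemma filtration_weaken j k x : (j <= k)%N -> filtration k x -> filtration j x.
Proof.
move=> jk; elim=> {x}.
- exact: filtration0.
- by move=> r x y _ hx _ hy; exact: filtrationZD.
- by move=> i u le hu; apply: (filtration_f1 _ hu); lia.
- by move=> i u le hu; apply: (filtration_f2 _ hu); lia.
- by move=> i l u v le hu hv; apply: (filtration_cross _ hu hv); lia.
Qed.

Lemma filtration_lie j k x y :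
  filtration j x -> filtration k y -> filtration (j + k) [lie x, y].
Proof.
move=> + hy; elim=> {x}.
- by rewrite lie0l; exact: filtration0.
- by move=> r x x' _ h1 _ h2; rewrite lieDl lieZl; exact: filtrationZD.
- move=> i u le hu; apply: filtration_weaken (filtration_act hu hy).1; lia.
- move=> i u le hu; apply: filtration_weaken (filtration_act hu hy).2; lia.
- move=> i l u v le hu hv; rewrite {1}/B lie_lieE.
  apply: filtrationD; last apply: filtrationN.
    have := (filtration_act hu (filtration_act hv hy).2).1.
    by apply: filtration_weaken; lia.
  have := (filtration_act hv (filtration_act hu hy).1).2.
  by apply: filtration_weaken; lia.
Qed.

Lemma filtration_top_eq0 x : filtration c.+2 x -> x = 0.
Proof.
elim=> {x} //.
- by move=> r x y _ -> _ ->; rewrite scaler0 addr0.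
- move=> i u le hu; rewrite (H_top _ hu); last lia.
  exact: lie_hom0.
- move=> i u le hu; rewrite (H_top _ hu); last lia.
  exact: lie_hom0.
- by move=> i j u v le hu hv; exact: cross_homogeneous_eq0 le hu hv.
Qed.

Lemma is_submodule_filtration k : is_submodule (filtration k).
Proof. by split; [exact: filtration0|move=> r x y; exact: filtrationZD]. Qed.

Hypothesis ab_gen : smallest (@is_lie_subalgebra K g) [set a; b] = setT.
Hypothesis f12_gen : forall S, is_lie_subalgebra S ->
  (forall x, S (f1 x)) -> (forall x, S (f2 x)) -> forall y : L, S y.

Lemma filtration1 y : filtration 1 y.
Proof.
have sub1 : is_lie_subalgebra (filtration 1).
  split; first exact: is_submodule_filtration.
  by move=> u v hu hv; apply: filtration_weaken (filtration_lie hu hv).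
suff h x : filtration 1 (f1 x) /\ filtration 1 (f2 x).
  by apply: f12_gen => // x; [exact: (h x).1|exact: (h x).2].
have : smallest (@is_lie_subalgebra K g) [set a; b] x by rewrite ab_gen.
move/(_ (fun x => filtration 1 (f1 x) /\ filtration 1 (f2 x))); apply.
split=> [|_ [->|->]].
- split; first split.
  + by split; rewrite lie_hom0 //; exact: filtration0.
  + move=> r u v [h1 h2] [h3 h4]; rewrite f1_hom.1 f2_hom.1.
    by split; exact: filtrationZD.
  + move=> u v [h1 h2] [h3 h4]; rewrite f1_hom.2 f2_hom.2.
    by split; apply: sub1.2.
- by split; [apply: (filtration_f1 (i := 1))|apply: (filtration_f2 (i := 1))];
    constructor.
- by split; [apply: (filtration_f1 (i := 1))|apply: (filtration_f2 (i := 1))];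
    constructor.
Qed.

Lemma lcs_filtration k x : lcs k x -> filtration k.+1 x.
Proof.
elim: k x => [|k IH] x; first by move=> _; exact: filtration1.
move/(_ (filtration k.+2)); apply; split; first exact: is_submodule_filtration.
move=> _ [u [v [/IH hu ->]]]; rewrite -(addn1 k.+1).
exact: filtration_lie hu (filtration1 v).
Qed.

Lemma lcs_eq0 : lcs c.+1 = [set 0 : L].
Proof.
apply/seteqP; split=> [x /lcs_filtration/filtration_top_eq0 //|_ ->] /=.
by move=> S [[S0 _] _].
Qed.

End WeakCommutativity.

(** * Generators and relations of [chi g] *)

Lemma lie_quot_pi_hom (K : fieldType) (L : lieAlgType K) (I : lieIdeal L) :
  is_lie_hom (lie_quot_pi I).
Proof.
have [[I0 IZD] IL] := lie_idealP I.
have addI x y : I x -> I y -> I (x + y).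
  by move=> hx; rewrite -[x]scale1r; exact: IZD.
have repE x : I (x - repr (lie_quot_pi I x)).
  by apply/lie_quot_piE; rewrite /lie_quot_pi reprK.
have IN x : I x -> I (- x).
  by move=> hx; rewrite -[- x]addr0 -scaleN1r; exact: IZD.
have IZ r x : I x -> I (r *: x).
  by move=> hx; rewrite -[_ *: x]addr0; exact: IZD.
split=> [r x y|x y]; apply/lie_quot_piE.
  set x' := repr _; set y' := repr _.
  rewrite opprD addrACA; apply: (addI _ _); last exact: repE.
  have -> : r *: x - x' = r *: (x - repr (lie_quot_pi I x))
      + (r *: repr (lie_quot_pi I x) - x') by rewrite scalerBr addrA subrK.
  by apply: (addI _ _); [apply: (IZ _ _); exact: repE|exact: repE].
set x' := repr _; set y' := repr _.
have -> : [lie x, y] - [lie x', y'] = [lie x, y - y'] - [lie y', x - x'].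
  by rewrite !lieBr (lieC y' x) (lieC y' x') opprK opprD opprK addrA addrNK.
by apply: (addI _ _); [|apply: IN]; apply: (IL _ _); exact: repE.
Qed.

Section FreeProductTerms.
Context (K : fieldType) (g1 g2 : lieAlgType K).
Local Notation pi := (@fp_pi K g1 g2).

Lemma fp_eq_repr t : fp_eq (repr (pi t)) t.
Proof. by apply/fp_piE; rewrite /fp_pi reprK. Qed.

Lemma fp_piD s t : pi (FpAdd s t) = pi s + pi t.
Proof. by apply/fp_piE/fp_sym; apply: fp_congD; exact: fp_eq_repr. Qed.

Lemma fp_piN t : pi (FpOpp t) = - pi t.
Proof. by apply/fp_piE/fp_sym; apply: fp_congN; exact: fp_eq_repr. Qed.

Lemma fp_piZ r t : pi (FpScale r t) = r *: pi t.
Proof. by apply/fp_piE/fp_sym; apply: fp_congZ; exact: fp_eq_repr. Qed.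

Lemma fp_piL s t : pi (FpLie s t) = [lie pi s, pi t].
Proof. by apply/fp_piE/fp_sym; apply: fp_congL; exact: fp_eq_repr. Qed.

Lemma freeprod_gen (S : set (freeprod g1 g2)) : is_lie_subalgebra S ->
    (forall x, S (fp_inl g2 x)) -> (forall x, S (fp_inr g1 x)) ->
  forall q, S q.
Proof.
move=> [[S0 SZD] SL] Sl Sr q; have -> : q = pi (repr q) by rewrite /fp_pi reprK.
elim: (repr q) => [x|x||s hs t ht|t ht|r t ht|s hs t ht].
- exact: Sl.
- exact: Sr.
- exact: S0.
- by rewrite fp_piD -[pi s]scale1r; exact: SZD.
- by rewrite fp_piN -[- _]addr0 -scaleN1r; exact: SZD.
- by rewrite fp_piZ -[_ *: _]addr0; exact: SZD.
- by rewrite fp_piL; exact: SL.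
Qed.

End FreeProductTerms.

Section Chi.
Context (K : fieldType) (g : lieAlgType K).

Let pi : freeprod g g -> chi g := lie_quot_pi (lie_ideal_gen (chi_relators g)).

Definition chi_inl : g -> chi g := pi \o @fp_inl K g g.
Definition chi_inr : g -> chi g := pi \o @fp_inr K g g.

Lemma chi_inl_hom : is_lie_hom chi_inl.
Proof. exact: is_lie_hom_comp (lie_quot_pi_hom _) (fp_inl_hom _ _). Qed.

Lemma chi_inr_hom : is_lie_hom chi_inr.
Proof. exact: is_lie_hom_comp (lie_quot_pi_hom _) (fp_inr_hom _ _). Qed.

Lemma chi_comm x : [lie chi_inl x, chi_inr x] = 0.
Proof.
have piL := (lie_quot_pi_hom (lie_ideal_gen (chi_relators g))).2.
rewrite /chi_inl /chi_inr /= -piL; apply/lie_quot_piE; rewrite subr0.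
by move=> S [_]; apply; exists x.
Qed.

Lemma chi_gen (S : set (chi g)) : is_lie_subalgebra S ->
    (forall x, S (chi_inl x)) -> (forall x, S (chi_inr x)) -> forall q, S q.
Proof.
move=> [[S0 SZD] SL] Sl Sr q.
have -> : q = pi (repr q) by rewrite /pi /lie_quot_pi reprK.
have [piZD piL] := lie_quot_pi_hom (lie_ideal_gen (chi_relators g)).
apply: (freeprod_gen (S := fun u => S (pi u))) => //.
split; first split.
- exact: S0.
- by move=> r x y hx hy; rewrite /pi piZD; exact: SZD.
- by move=> x y hx hy; rewrite /pi piL; exact: SL.
Qed.

End Chi.

Local Close Scope classical_set_scope.
Local Close Scope ring_scope.

Theorem proposition4p2 (K : fieldType) (hK : 2 \notin [pchar K]%R)
    (g : lieAlgType K) (c : nat) (hgen : two_generated g)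
    (hnil : nilpotent_of_class g c) :
  exists2 d : nat, nilpotent_of_class (chi g) d & d <= c.+1.
Proof.
have [a [b ab_gen]] := hgen; apply: nilpotent_of_class_le.
apply: (lcs_eq0 hK (chi_inl_hom g) (chi_inr_hom g) (@chi_comm K g) _ ab_gen
  (@chi_gen K g)) => -[//|k] x ck /homogeneous_lcs.
exact: lcs0_weaken hnil.1 ck.
Qed.
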